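(* Let $$U_n=n\int_{[0,1]^d}\Big(C_n(\mathbf{u})-\prod_{j=1}^d u_j\Big)^2\,d\mathbf{u}$$ be the uniformly weighted Cramér–von Mises statistic (weight $w(\mathbf{u})=1$ for $\mathbf{u}\in[0,1]^d$). Then $$U_n=\sum_{i=1}^n\left[\frac1n\sum_{l=1}^n\prod_{j=1}^d\big(1-\hat U_{i,j}\vee\hat U_{l,j}\big)-2\prod_{j=1}^d\frac12\big(1-\hat U_{i,j}^2\big)\right]+n\,3^{-d}.$$
   Context: Let $d\ge2$ and let $(X_{i,1},\dots,X_{i,d})$, $i=1,\dots,n$, be a sample of $n$ observations in $\mathbb{R}^d$. With $\mathbb{I}$ the indicator function, set $\hat F_j(x)=\frac1n\sum_{i=1}^n\mathbb{I}(X_{i,j}\le x)$, $\hat U_{i,j}=\hat F_j(X_{i,j})$, and let the empirical copula be $$C_n(\mathbf{u})=\frac1n\sum_{i=1}^n\prod_{j=1}^d\mathbb{I}(\hat U_{i,j}\le u_j),\qquad\mathbf{u}\in[0,1]^d.$$ Write $a\vee b=\max(a,b)$; in particular $1-\hat U_{i,j}\vee\hat U_{l,j}$ means $1-\max(\hat U_{i,j},\hat U_{l,j})$. *)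

(* Defs.v *)
From HB Require Import structures.
From mathcomp Require Export all_boot all_order all_algebra.
From mathcomp Require Export all_classical all_reals all_analysis.
Set Implicit Arguments.
Unset Strict Implicit.
Unset Printing Implicit Defensive.
Import Order.TTheory GRing.Theory Num.Theory.
Import numFieldNormedType.Exports.
Local Open Scope classical_set_scope.
Local Open Scope ring_scope.

Section lebesgue_tuple.
Context {R : realType}.
Local Notation RB := (measurableTypeR R).

Definition tcons n (p : RB * n.-tuple RB) : n.+1.-tuple RB :=
  [the n.+1.-tuple RB of p.1 :: p.2].

Lemma tnth_tcons n (p : RB * n.-tuple RB) (j : 'I_n) :
  tnth (tcons p) (lift ord0 j) = tnth p.2 j.
Proof. exact: tnthS. Qed.

Lemma measurable_tcons n : measurable_fun [set: RB * n.-tuple RB] (@tcons n).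
Proof. exact: measurable_cons measurable_fst measurable_snd. Qed.

HB.instance Definition _ n :=
  isMeasurableFun.Build _ _ _ _ (@tcons n) (@measurable_tcons n).

Definition lebesgue_cons n
    (mu : {sigma_finite_measure set (n.-tuple RB) -> \bar R}) :=
  pushforward (@lebesgue_measure R \x mu)%E (@tcons n).

Section lebesgue_cons.
Variables (n : nat) (mu : {sigma_finite_measure set (n.-tuple RB) -> \bar R}).

Let lebesgue_cons0 : (lebesgue_cons mu set0 = 0)%E.
Proof. by rewrite /lebesgue_cons /pushforward preimage_set0 measure0. Qed.

Let lebesgue_cons_ge0 A : (0 <= lebesgue_cons mu A)%E.
Proof. exact: measure_ge0. Qed.

Let lebesgue_cons_sigma_additive : semi_sigma_additive (lebesgue_cons mu).
Proof.
move=> F mF tF mUF.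
have mpre A : measurable A -> measurable (@tcons n @^-1` A).
  by move=> mA; rewrite -[X in measurable X]setTI; exact: measurable_tcons.
rewrite /lebesgue_cons /pushforward preimage_bigcup.
apply: measure_semi_sigma_additive; first by move=> k; exact: mpre.
- apply/trivIsetP => /= i j _ _ ij; rewrite -preimage_setI.
  by move/trivIsetP : tF => /(_ _ _ _ _ ij) ->//; rewrite preimage_set0.
- by rewrite -preimage_bigcup; exact: mpre.
Qed.

HB.instance Definition _ := isMeasure.Build _ _ _ (lebesgue_cons mu)
  lebesgue_cons0 lebesgue_cons_ge0 lebesgue_cons_sigma_additive.

Let lebesgue_cons_sigma_finite : sigma_finite setT (lebesgue_cons mu).
Proof.
pose g (t : n.+1.-tuple RB) : RB * n.-tuple RB := (thead t, [tuple of behead t]).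
have mg : measurable_fun setT g.
  apply: measurable_fun_pair; last exact: measurable_behead.
  exact: measurable_tnth.
have gK p : g (tcons p) = p.
  by case: p => x t; rewrite /g theadE; congr pair; apply: val_inj.
have /sigma_finiteP[F [TF ndF Foo]] := sigma_finiteT (@lebesgue_measure R).
have /sigma_finiteP[G [TG ndG Goo]] := sigma_finiteT mu.
exists (fun k => g @^-1` (F k `*` G k)).
  rewrite -preimage_bigcup (_ : \bigcup_k _ = setT) ?preimage_setT//.
  rewrite -subTset => -[x t] _.
  have [i _ Fx] : (\bigcup_i F i) x by rewrite -TF.
  have [j _ Gt] : (\bigcup_j G j) t by rewrite -TG.
  exists (maxn i j) => //; split => /=.
    by move: x Fx; exact/subsetPset/ndF/leq_maxl.
  by move: t Gt; exact/subsetPset/ndG/leq_maxr.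
move=> k; have [mF Fk] := Foo k; have [mG Gk] := Goo k; split.
  by rewrite -[X in measurable X]setTI; apply: mg => //; exact: measurableX.
rewrite /lebesgue_cons /pushforward.
rewrite (_ : _ @^-1` (g @^-1` _) = F k `*` G k); last first.
  by apply/funext => p; exact: (congr1 (F k `*` G k) (gK p)).
by rewrite product_measure1E// lte_mul_pinfty// ge0_fin_numE.
Qed.

HB.instance Definition _ :=
  Measure_isSigmaFinite.Build _ _ _ (lebesgue_cons mu) lebesgue_cons_sigma_finite.

End lebesgue_cons.

(* d-dimensional Lebesgue measure on the Borel sets of R^d, as the iterated
   product of the one-dimensional one; R^0 is a point, of mass 1. *)
Fixpoint lebesgue_tuple d : {sigma_finite_measure set (d.-tuple RB) -> \bar R} :=
  if d is n.+1 then lebesgue_cons (lebesgue_tuple n) else dirac [tuple].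

Lemma lebesgue_tuple_box d (A : 'I_d -> set RB) :
  (forall j, measurable (A j)) ->
  lebesgue_tuple d [set u | forall j, A j (tnth u j)] =
  (\prod_(j < d) lebesgue_measure (A j))%E.
Proof.
elim: d A => [|d IH] A mA.
  by rewrite big_ord0 /= /dirac indicE mem_set// => -[].
rewrite big_ord_recl/= /lebesgue_cons /pushforward.
pose B : set (d.-tuple RB) := [set u | forall j, A (lift ord0 j) (tnth u j)].
have -> : @tcons d @^-1` [set u | forall j, A j (tnth u j)] = A ord0 `*` B.
  apply/seteqP; split=> [[x u] H|[x u] [Ax Bu] j].
    by split; [exact: (H ord0)|move=> j; have := H (lift ord0 j); rewrite tnth_tcons].
  have [->//|[i ->]] : j = ord0 \/ exists i, j = lift ord0 i.
    by case: (unliftP ord0 j) => [i ->|->]; [right; exists i|left].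
  by rewrite tnth_tcons; exact: Bu.
have mB : measurable B.
  have -> : B = \bigcap_(j in [set: 'I_d])
      ((fun u : d.-tuple RB => tnth u j) @^-1` A (lift ord0 j)).
    by apply/seteqP; split=> [u Bu j _|u H j]; [exact: Bu|exact: H].
  apply: fin_bigcap_measurable => // j _.
  by rewrite -[X in measurable X]setTI; exact: measurable_tnth.
by rewrite product_measure1E// -IH.
Qed.

End lebesgue_tuple.
Arguments lebesgue_tuple R d : clear implicits.

Section empirical_copula.
Context {R : realType} {n d : nat}.
Variable X : 'I_n -> 'I_d -> R.

Definition emp_cdf (j : 'I_d) (x : R) : R :=
  n%:R^-1 * \sum_(i < n) (X i j <= x)%R%:R.

Definition pseudo_obs (i : 'I_n) (j : 'I_d) : R := emp_cdf j (X i j).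

Definition emp_copula (u : d.-tuple (measurableTypeR R)) : R :=
  n%:R^-1 * \sum_(i < n) \prod_(j < d) (pseudo_obs i j <= tnth u j)%R%:R.

Definition unit_cube : set (d.-tuple (measurableTypeR R)) :=
  [set u | forall j, 0 <= tnth u j <= 1].

Definition cvm_stat : R :=
  n%:R * \int[lebesgue_tuple R d]_(u in unit_cube)
           (emp_copula u - \prod_(j < d) (tnth u j : R)) ^+ 2.

End empirical_copula.

(* Main.v *)
Require Import Defs.
From mathcomp Require Import measurable_realfun ring.
Import Order.TTheory GRing.Theory Num.Theory.
Import numFieldNormedType.Exports.
Local Open Scope ring_scope.
Local Open Scope classical_set_scope.

(** Write [U] for the pseudo-observations. Expanding the square and using
    that a product of indicators of [a <= x] and [b <= x] is the indicator of
    [max a b <= x], the integrand becomes a finite linear combination of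
    functions that factor over the coordinates ([emp_copula_sub_sqr]):
    - the square of the empirical copula gives, for each pair [i], [l], the
      product over [j] of the indicators of [max U_ij U_lj <= u_j];
    - the cross term gives, for each [i], the product over [j] of [u_j] times
      the indicator of [U_ij <= u_j];
    - the square of the independence copula gives the product of the [u_j ^ 2].

    All three are instances of one family, the product over [j] of [u_j ^ k]
    times the indicator of [c_j <= u_j], with [k = 0, 1, 2]
    ([corner_monomial]). By Tonelli ([integral_prod_tnth]) the integral of
    such a function over the cube is the product of the integrals of [x ^ k]
    over [[c_j, 1]], namely of [(1 - c_j ^ (k + 1)) / (k + 1)]
    ([has_Rintegral_corner_monomial]). For [k = 0, 1, 2] these factors are
    [1 - max U_ij U_lj], [(1 - U_ij ^ 2) / 2] and, with [c = 0], [1 / 3],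
    which are the three kinds of terms of the formula; linearity of the
    integral then gives the result. *)

Section product_integral.
Context {R : realType}.
Local Notation RB := (measurableTypeR R).

Lemma measurable_prod_tnth d (g : 'I_d -> RB -> R) :
  (forall j, measurable_fun setT (g j)) ->
  measurable_fun [set: d.-tuple RB] (fun u => \prod_(j < d) g j (tnth u j)).
Proof.
move=> mg; apply: measurable_prod => j _.
exact: measurableT_comp (mg j) (measurable_tnth j).
Qed.

(** The measure on tuples of length [d + 1] is the image of a product measure,
    so Tonelli peels off the first coordinate, and induction does the rest.
    Nonnegativity spares any integrability assumption on the factors. *)
Lemma integral_prod_tnth d (g : 'I_d -> RB -> R) :
  (forall j, measurable_fun setT (g j)) -> (forall j x, 0 <= g j x) ->
  (\int[lebesgue_tuple R d]_u (\prod_(j < d) g j (tnth u j))%:E =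
   \prod_(j < d) \int[lebesgue_measure]_x (g j x)%:E)%E.
Proof.
elim: d g => [|d IH] g mg g0.
  rewrite [in RHS]big_ord0 /=.
  under eq_integral do rewrite big_ord0.
  by rewrite integral_cst//= diracT mule1.
rewrite [in RHS]big_ord_recl/= /lebesgue_cons.
have mE k (h : 'I_k -> RB -> R) : (forall j, measurable_fun setT (h j)) ->
    measurable_fun [set: k.-tuple RB]
      (EFin \o (fun u => \prod_(j < k) h j (tnth u j))).
  by move=> mh; apply/measurable_EFinP; exact: measurable_prod_tnth.
have p0 k (h : 'I_k -> RB -> R) : (forall j x, 0 <= h j x) ->
    forall u : k.-tuple RB, (0 <= (\prod_(j < k) h j (tnth u j))%:E)%E.
  by move=> h0 u; rewrite lee_fin prodr_ge0.
rewrite (ge0_integral_pushforward (@measurable_tcons R d))//=; last 2 first.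
  exact: mE.
  by move=> u _; exact: p0.
rewrite preimage_setT fubini_tonelli1/=; last 2 first.
  exact: measurableT_comp (mE _ _ mg) (@measurable_tcons R d).
  by move=> z; exact: p0.
(* The inner integral is a nonnegative constant for the outer one. *)
pose I := (\int[lebesgue_tuple R d]_u
  (\prod_(j < d) g (lift ord0 j) (tnth u j))%:E)%E.
rewrite -IH// -/I.
have mg0 : measurable_fun setT (EFin \o g ord0) by exact/measurable_EFinP.
rewrite -(ge0_integralZr lebesgue_measure _ mg0)//; last 2 first.
- by move=> x _; rewrite lee_fin.
- by apply: integral_ge0 => u _; exact: (p0 _ (fun j => g (lift ord0 j))).
apply: eq_integral => x _; rewrite /fubini_F/=.
rewrite -ge0_integralZl_EFin//; last 2 first.
- by move=> u _; exact: (p0 _ (fun j => g (lift ord0 j))).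
- exact: (mE _ (fun j => g (lift ord0 j))).
apply: eq_integral => u _; rewrite -EFinM big_ord_recl.
by congr ((_ * _)%:E); apply: eq_bigr => j _; rewrite tnth_tcons.
Qed.

Lemma measurable_unit_cube d : measurable (@unit_cube R d).
Proof.
have -> : @unit_cube R d = \bigcap_(j in [set: 'I_d])
    ((fun u : d.-tuple RB => tnth u j) @^-1` `[0, 1]).
  by apply/seteqP; split=> u /= H j => [_|]; have := H j; rewrite /= in_itv/=; auto.
apply: fin_bigcap_measurable => // j _.
by rewrite -[X in measurable X]setTI; exact: measurable_tnth.
Qed.

End product_integral.

Section power_integral.
Context {R : realType}.

Lemma integral_pow_itv (c : R) k : c <= 1 ->
  (\int[lebesgue_measure]_(x in `[c, 1%R]) (x ^+ k)%:E)%E =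
   ((1 - c ^+ k.+1) / k.+1%:R)%:E.
Proof.
rewrite le_eqVlt => /predU1P[->|c1].
  (* The fundamental theorem of calculus needs a nondegenerate interval. *)
  by rewrite set_itv1 integral_set1 expr1n subrr mul0r.
(* F is built from the operations of the ring of functions so that the
   derivative can be found by instance resolution. *)
pose F : R -> R := k.+1%:R^-1 *: (id ^+ k.+1).
have FE (x : R) : F x = k.+1%:R^-1 * x ^+ k.+1 by rewrite /F !fctE.
have dF (x : R) : is_derive x 1 F (x ^+ k).
  apply: is_derive_eq.
  by rewrite scalerA mulrA mulVf ?pnatr_eq0// mul1r -[RHS]mulr1.
have cF (x : R) : {for x, continuous F}.
  apply/differentiable_continuous/derivable1_diffP; exact: ex_derive.
rewrite (@continuous_FTC2 _ _ F)//.
- by rewrite !FE expr1n -EFinB -mulrBr mulrC.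
- by apply: continuous_in_subspaceT => x _; exact: exprn_continuous.
- split=> [x _||]; first exact: ex_derive.
    exact/cvg_at_right_filter/cF.
  exact/cvg_at_left_filter/cF.
- by move=> x _; rewrite derive1E derive_val.
Qed.

End power_integral.

Section has_Rintegral.
Context {d} {T : measurableType d} {R : realType}.
Variables (mu : {measure set T -> \bar R}) (D : set T) (mD : measurable D).

(** The real-valued integral is additive only on integrable functions; bundling
    integrability with the value lets both propagate through a linear
    combination in a single pass. *)
Definition has_Rintegral (f : T -> R) (v : R) :=
  mu.-integrable D (EFin \o f) /\ \int[mu]_(x in D) f x = v.

Lemma has_RintegralD f g a b : has_Rintegral f a -> has_Rintegral g b ->
  has_Rintegral (fun x => f x + g x) (a + b).
Proof.
move=> [fi <-] [gi <-]; split; last exact: RintegralD.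
exact: (@integrableD _ _ _ mu _ mD (EFin \o f) (EFin \o g)).
Qed.

Lemma has_RintegralZ f a r : has_Rintegral f a ->
  has_Rintegral (fun x => r * f x) (r * a).
Proof.
move=> [fi <-]; split; last exact: RintegralZl.
exact: (integrableZl mD r fi).
Qed.

Lemma has_Rintegral_sum (I : Type) (s : seq I) (f : I -> T -> R) (a : I -> R) :
  (forall i, has_Rintegral (f i) (a i)) ->
  has_Rintegral (fun x => \sum_(i <- s) f i x) (\sum_(i <- s) a i).
Proof.
move=> fa; elim: s => [|i s IH].
  rewrite big_nil; under eq_fun do rewrite big_nil.
  by split; [exact: integrable0|rewrite Rintegral_cst// mul0r].
rewrite big_cons; under eq_fun do rewrite big_cons.
exact: has_RintegralD.
Qed.

Lemma eq_has_Rintegral f g a : {in D, f =1 g} ->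
  has_Rintegral g a -> has_Rintegral f a.
Proof.
move=> fg [gi <-]; split; last exact: eq_Rintegral.
by apply: eq_integrable gi => // x xD /=; rewrite fg.
Qed.

End has_Rintegral.

Section corner_monomial.
Context {R : realType}.
Local Notation RB := (measurableTypeR R).

(** The common shape of all the terms in the expanded square: the indicator of
    the orthant with corner [c], times the [k]-th power of the product of the
    coordinates. It is written as one product over the coordinates, the form to
    which Tonelli applies. *)
Definition corner_monomial {d} k (c : 'I_d -> R) (u : d.-tuple RB) : R :=
  \prod_(j < d) ((c j <= tnth u j)%R%:R * (tnth u j : R) ^+ k).

(** On the cube, the factor of index [j] is supported on [[c j, 1]], so the
    integral splits into the integrals of [x ^ k] over these intervals. *)
Lemma has_Rintegral_corner_monomial d k (c : 'I_d -> R) :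
  (forall j, 0 <= c j <= 1) ->
  has_Rintegral (lebesgue_tuple R d) unit_cube (corner_monomial k c)
    (\prod_(j < d) ((1 - c j ^+ k.+1) / k.+1%:R)).
Proof.
move=> c01.
(* Unlike the factors of the corner monomial, g j vanishes outside [0, 1]: the
   product of the g j is the corner monomial extended by zero, which turns the
   integral over the cube into one over the whole space. *)
pose g j (x : RB) : R := \1_`[c j, 1] x * x ^+ k.
have mg j : measurable_fun setT (g j).
  apply: measurable_funM; first exact: measurable_indic.
  exact: measurable_funX.
have g0 j x : 0 <= g j x.
  rewrite /g indicE mem_setE in_itv/=; case: (boolP (_ <= _ <= _)) => [/andP[cx _]|_].
    by rewrite mul1r exprn_ge0// (le_trans _ cx)//; case/andP: (c01 j).
  by rewrite mul0r.
have gE (u : d.-tuple RB) : unit_cube u ->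
    corner_monomial k c u = \prod_(j < d) g j (tnth u j).
  move=> uc; apply: eq_bigr => j _; rewrite /g indicE mem_setE in_itv/=.
  by case/andP: (uc j) => _ ->; rewrite andbT.
have g_out (u : d.-tuple RB) : ~ unit_cube u -> \prod_(j < d) g j (tnth u j) = 0.
  move=> /existsNP[j /negP uj]; apply/eqP/prodf_eq0; exists j => //.
  rewrite /g indicE mem_setE in_itv/=.
  case: (boolP (_ <= _ <= _)) => [/andP[cu u1]|_]; last by rewrite mul0r.
  case/negP: uj; rewrite u1 andbT (le_trans _ cu)//.
  by case/andP: (c01 j).
have intE : (\int[lebesgue_tuple R d]_(u in unit_cube) (corner_monomial k c u)%:E =
    (\prod_(j < d) ((1 - c j ^+ k.+1) / k.+1%:R))%:E)%E.
  rewrite integral_mkcond.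
  transitivity (\int[lebesgue_tuple R d]_u (\prod_(j < d) g j (tnth u j))%:E)%E.
    apply: eq_integral => u _; rewrite patchE; case: ifPn => [/set_mem/gE ->//|].
    by move=> /negP uc; rewrite g_out// => /mem_set.
  rewrite integral_prod_tnth// -prodEFin; apply: eq_bigr => j _.
  rewrite -integral_pow_itv; last by case/andP: (c01 j).
  rewrite [RHS]integral_mkcond; apply: eq_integral => x _.
  by rewrite patchE /g indicE; case: (_ \in _); rewrite ?mul1r ?mul0r.
split; last by rewrite /Rintegral intE.
apply/integrableP; split.
  apply/measurable_EFinP; apply: (measurable_funS measurableT) => //.
  apply: (measurable_prod_tnth _
    (fun j (x : RB) => (c j <= x)%R%:R * (x : R) ^+ k)) => j.
  apply: measurable_funM; last exact: measurable_funX.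
  rewrite (_ : (fun _ => _) = \1_`[c j, +oo[); first exact: measurable_indic.
  by apply/funext => x; rewrite indicE mem_setE in_itv/= andbT.
(* The monomial is nonnegative on the cube, so the integral of its absolute
   value is the finite value just computed. *)
rewrite (_ : (\int[_]_(_ in _) _)%E =
    (\prod_(j < d) ((1 - c j ^+ k.+1) / k.+1%:R))%:E) ?ltry//.
rewrite -intE; apply: eq_integral => u /set_mem uc /=.
by rewrite ger0_norm// gE// prodr_ge0.
Qed.

End corner_monomial.

Lemma pseudo_obs_itv {R : realType} {n d : nat} (X : 'I_n -> 'I_d -> R) i j :
  0 <= pseudo_obs X i j <= 1.
Proof.
have n0 : (0 < n%:R :> R) by rewrite ltr0n (leq_trans _ (ltn_ord i)).
rewrite /pseudo_obs /emp_cdf mulrC divr_ge0 ?sumr_ge0 ?ler0n//=.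
rewrite ler_pdivrMr// mul1r -[n in leRHS]card_ord -sumr_const ler_sum// => l _.
by rewrite lern1 leq_b1.
Qed.

(** This is where the maxima of the formula come from: two indicators of
    half-lines multiply to the indicator of the half-line that starts at the
    larger endpoint. *)
Lemma emp_copula_sub_sqr {R : realType} {n d : nat} (X : 'I_n -> 'I_d -> R)
    (u : d.-tuple (measurableTypeR R)) : unit_cube u ->
  (emp_copula X u - \prod_(j < d) (tnth u j : R)) ^+ 2 =
  n%:R^-1 * (n%:R^-1 * \sum_(i < n) \sum_(l < n) corner_monomial 0
    (fun j => Num.max (pseudo_obs X i j) (pseudo_obs X l j)) u)
  + (- (2 * n%:R^-1) * \sum_(i < n) corner_monomial 1 (pseudo_obs X i) u
     + corner_monomial 2 (fun=> 0) u).
Proof.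
move=> uc.
pose c i : R := \prod_(j < d) (pseudo_obs X i j <= tnth u j)%R%:R.
pose p : R := \prod_(j < d) (tnth u j : R).
have cm0 i l : corner_monomial 0
    (fun j => Num.max (pseudo_obs X i j) (pseudo_obs X l j)) u = c i * c l.
  rewrite /c -big_split; apply: eq_bigr => j _ /=.
  by rewrite ge_max expr0 mulr1 -natrM mulnb.
have cm1 i : corner_monomial 1 (pseudo_obs X i) u = c i * p.
  by rewrite /c /p -big_split.
(* The indicator of the orthant at the origin is 1 throughout the cube. *)
have cm2 : corner_monomial 2 (fun=> 0) u = p ^+ 2.
  rewrite /p -prodrXl; apply: eq_bigr => j _ /=.
  by case/andP: (uc j) => -> _; rewrite mul1r.
have -> : \sum_(i < n) \sum_(l < n) corner_monomial 0
    (fun j => Num.max (pseudo_obs X i j) (pseudo_obs X l j)) u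
    = (\sum_(i < n) c i) ^+ 2.
  rewrite expr2 mulr_suml; apply: eq_bigr => i _.
  by rewrite mulr_sumr; apply: eq_bigr => l _.
have -> : \sum_(i < n) corner_monomial 1 (pseudo_obs X i) u
    = (\sum_(i < n) c i) * p.
  by rewrite mulr_suml; apply: eq_bigr => i _.
rewrite cm2 /emp_copula -/p.
ring.
Qed.

Theorem proposition3 (R : realType) (d n : nat) (hd : (2 <= d)%N)
    (hn : (0 < n)%N) (X : 'I_n -> 'I_d -> R) :
  cvm_stat X =
    \sum_(i < n)
      (n%:R^-1 * \sum_(l < n) \prod_(j < d)
          (1 - Num.max (pseudo_obs X i j) (pseudo_obs X l j))
       - 2 * \prod_(j < d) (2^-1 * (1 - pseudo_obs X i j ^+ 2)))
    + n%:R * 3 ^- d.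
Proof.
have n0 : n%:R != 0 :> R by rewrite pnatr_eq0 -lt0n.
have U01 i j := pseudo_obs_itv X i j.
have max01 i l j : 0 <= Num.max (pseudo_obs X i j) (pseudo_obs X l j) <= 1.
  by rewrite le_max ge_max; move: (U01 i j) (U01 l j) => /andP[-> ->] /andP[_ ->].
have [_ int_sqr] : has_Rintegral (lebesgue_tuple R d) unit_cube
    (fun u => (emp_copula X u - \prod_(j < d) (tnth u j : R)) ^+ 2)
    (n%:R^-1 * (n%:R^-1 * \sum_(i < n) \sum_(l < n)
       \prod_(j < d) ((1 - Num.max (pseudo_obs X i j) (pseudo_obs X l j) ^+ 1) / 1%:R))
     + (- (2 * n%:R^-1) * \sum_(i < n)
          \prod_(j < d) ((1 - pseudo_obs X i j ^+ 2) / 2%:R)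
        + \prod_(j < d) ((1 - 0 ^+ 3) / 3%:R))).
  apply: eq_has_Rintegral; first exact: measurable_unit_cube.
    by move=> u /set_mem; exact: emp_copula_sub_sqr.
  have mC := @measurable_unit_cube R d.
  apply: has_RintegralD => //; last apply: has_RintegralD => //.
  - do 2 apply: has_RintegralZ => //.
    apply: has_Rintegral_sum => // i; apply: has_Rintegral_sum => // l.
    exact: has_Rintegral_corner_monomial.
  - apply: has_RintegralZ => //; apply: has_Rintegral_sum => // i.
    exact: has_Rintegral_corner_monomial.
  - by apply: has_Rintegral_corner_monomial => j; rewrite lexx ler01.
rewrite /cvm_stat int_sqr.
rewrite sumrB -!mulr_sumr prodr_const card_ord expr0n subr0 mul1r exprVn.
have -> : \sum_(i < n) \sum_(l < n) \prod_(j < d)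
      ((1 - Num.max (pseudo_obs X i j) (pseudo_obs X l j) ^+ 1) / 1%:R)
    = \sum_(i < n) \sum_(l < n) \prod_(j < d)
        (1 - Num.max (pseudo_obs X i j) (pseudo_obs X l j)).
  do 3 apply: eq_bigr => ? _.
  by rewrite expr1 divr1.
have -> : \sum_(i < n) \prod_(j < d) ((1 - pseudo_obs X i j ^+ 2) / 2%:R)
    = \sum_(i < n) \prod_(j < d) (2^-1 * (1 - pseudo_obs X i j ^+ 2)).
  by do 2 apply: eq_bigr => ? _; rewrite mulrC.
by field; rewrite ?n0 ?expf_neq0 ?pnatr_eq0.
Qed.
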